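(* Let $n=2m$ and let $h\in G(m)=SO_{2m+1}(F)$ be semisimple. Then there is a $Y\in GL_n(F)$ and an $X\in M_{n\times(2m+1)}(F)$ with $Y+\tilde\varepsilon(Y)=XX'$ such that $\{h\}=\{I-X'Y^{-1}X\}$, where $\{\cdot\}$ denotes the conjugacy class in $G(m)$.
   Context: $F$ is a nonarchimedean local field of characteristic zero. $w_k$ is the $k\times k$ antidiagonal matrix with all antidiagonal entries $1$, and $SO_{2m+1}(F)$ is the special orthogonal group of the symmetric form $w_{2m+1}$. For $Y\in M_n(F)$, $\tilde\varepsilon(Y)=w_n\,{}^tY\,w_n$; for $X\in M_{n\times(2m+1)}(F)$, $X'=-w_{2m+1}\,{}^tX\,w_n$. *)

(* Defs.v *)
From mathcomp Require Import all_boot all_order all_algebra.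
From mathcomp Require Import boolp classical_sets.

Set Implicit Arguments.
Unset Strict Implicit.
Unset Printing Implicit Defensive.

Import Order.TTheory GRing.Theory Num.Theory.
Local Open Scope ring_scope.
Local Open Scope classical_set_scope.

Section LocalField.
Variables (F : fieldType) (v : F -> int).

(* Membership in the k-th power of the maximal ideal; v 0 is a junk value. *)
Definition val_ge (k : int) (x : F) : bool := (x == 0) || (k <= v x).

Definition val_cauchy (u : nat -> F) : Prop :=
  forall k : int, exists N : nat, forall i j : nat,
    (N <= i)%N -> (N <= j)%N -> val_ge k (u i - u j).

Definition val_cvg (u : nat -> F) (l : F) : Prop :=
  forall k : int, exists N : nat, forall i : nat,
    (N <= i)%N -> val_ge k (u i - l).

(* F is a complete discretely valued field with finite residue field, and v
   is its normalised valuation. *)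
Record local_field_valuation : Prop := LocalFieldValuation {
  lfv_mul : forall x y : F, x != 0 -> y != 0 -> v (x * y) = v x + v y;
  lfv_add : forall x y : F, x != 0 -> y != 0 -> x + y != 0 ->
    Num.min (v x) (v y) <= v (x + y);
  lfv_uniformizer : exists2 x : F, x != 0 & v x = 1;
  lfv_complete : forall u : nat -> F, val_cauchy u -> exists l : F, val_cvg u l;
  lfv_residue_finite : exists s : seq F, forall x : F, val_ge 0 x ->
    exists2 r : F, r \in s & val_ge 1 (x - r)
}.

End LocalField.

Definition nonarchimedean_local_field (F : fieldType) : Prop :=
  exists v : F -> int, local_field_valuation v.

Definition algebraic_closure (F L : fieldType) (f : {rmorphism F -> L}) : Prop :=
  GRing.closed_field_axiom L /\ integralRange f.

Definition semisimple_mx (F : fieldType) (k : nat) (A : 'M[F]_k) : Prop :=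
  exists (L : fieldType) (f : {rmorphism F -> L}),
    algebraic_closure f /\ diagonalizable (map_mx f A).

Section OrthogonalGroup.
Variable F : fieldType.

Definition antidiag_mx (k : nat) : 'M[F]_k :=
  \matrix_(i < k, j < k) (j == rev_ord i)%:R.

Definition SO_odd (m : nat) : set 'M[F]_((2 * m).+1) :=
  [set g | g^T *m antidiag_mx (2 * m).+1 *m g = antidiag_mx (2 * m).+1 /\
           \det g = 1].

Definition SO_class (m : nat) (h : 'M[F]_((2 * m).+1)) :
    set 'M[F]_((2 * m).+1) :=
  [set g *m h *m invmx g | g in @SO_odd m].

Definition tilde_eps (n : nat) (Y : 'M[F]_n) : 'M[F]_n :=
  antidiag_mx n *m Y^T *m antidiag_mx n.

Definition mx_prime (n m : nat) (X : 'M[F]_(n, (2 * m).+1)) :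
    'M[F]_((2 * m).+1, n) :=
  - (antidiag_mx (2 * m).+1 *m X^T *m antidiag_mx n).

End OrthogonalGroup.

Arguments SO_odd : clear implicits.

(* Main.v *)
(** Write [J] for the Gram matrix [w] and put [A = J (h - 1)].  Orthogonality
    of [h] says [A + A^T = - A^T J A], so [A] and [A^T] have the same kernel and
    [A = R^T M R] with [R] a basis of the row space of [A] and [M] invertible of
    size [r = rank (h - 1)]; then [M^-1 + M^-T = - R J R^T] (Wall's
    parametrization).  By Sylvester's determinant identity
    [det h = det (1 + M R J R^T) = (-1)^r], so [r] is even, hence at most [2m],
    and [R], [M^-1] can be padded to size [2m] with zero rows and an invertible
    alternating block.  This realizes [h] itself as [1 - X' Y^-1 X], with
    [Y = B w_n] where [B] is the padded [M^-1]. *)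

Require Import Defs.
From mathcomp Require Import all_boot all_order all_algebra.
From mathcomp Require Import boolp classical_sets.
From mathcomp Require Import zify.

Import GRing.Theory.
Local Open Scope ring_scope.

(** Two block upper triangular matrices with these determinants are conjugate under a unipotent
    block lower triangular one. *)
Lemma det_add1_mulmxC (R : comPzRingType) (p q : nat)
    (U : 'M[R]_(p, q)) (V : 'M[R]_(q, p)) :
  \det (1%:M + U *m V) = \det (1%:M + V *m U).
Proof.
have E : block_mx (1%:M + U *m V) (- U) 0 1%:M *m block_mx 1%:M 0 V 1%:M =
         block_mx 1%:M 0 V 1%:M *m block_mx 1%:M (- U) 0 (1%:M + V *m U).
  rewrite !mulmx_block !(mulmx1, mul1mx, mulmx0, mul0mx, addr0, add0r).
  by rewrite mulNmx mulmxN addrK addrC addrK.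
by have := congr1 determinant E;
  rewrite !det_mulmx !det_ublock !det_lblock !det1 !(mulr1, mul1r).
Qed.

Section WallForm.
Variables (F : fieldType) (N : nat) (J : 'M[F]_N).
Hypotheses (JJ : J *m J = 1%:M) (JT : J^T = J).

Lemma isometry_sub1 (h : 'M[F]_N) (A := J *m (h - 1%:M)) :
  h^T *m J *m h = J -> A = - (A^T *m h) /\ h = 1%:M + J *m A.
Proof.
move=> hJ; split; last by rewrite /A mulmxA JJ mul1mx addrC subrK.
rewrite /A trmx_mul JT [(_ - _)^T]raddfB /= trmx1 mulmxBl mul1mx mulmxBl hJ opprB.
by rewrite mulmxBr mulmx1.
Qed.

Lemma wall_decomposition (h : 'M[F]_N) (r := \rank (h - 1%:M)) :
  h^T *m J *m h = J ->
  exists (R : 'M[F]_(r, N)) (M : 'M[F]_r),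
    [/\ M \in unitmx, invmx M + (invmx M)^T = - (R *m J *m R^T) &
        h = 1%:M + J *m R^T *m M *m R].
Proof.
move=> hJ; have [At hE] := isometry_sub1 _ hJ.
set A := J *m (h - 1%:M) in At hE.
have Ju : J \in unitmx by case: (mulmx1_unit JJ).
have [R [K [Rfree Kr AKR]]] : exists (R : 'M_(r, N)) (K : 'M_(N, r)),
    [/\ row_free R, \rank K = r & A = K *m R].
  have -> : r = \rank A.
    rewrite /r -mxrank_tr -[RHS]mxrank_tr trmx_mul mxrankMfree //.
    by rewrite row_free_unit unitmx_tr.
  exists (row_base A), (col_base A); rewrite row_base_free mulmx_base.
  by split=> //; apply/eqP; rewrite -/(row_full _) col_base_full.
(* Comparing [K R = A = - A^T h = - R^T K^T h] and cancelling the row-free [R] on the right forces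
   this choice. *)
pose M := - (K^T *m h *m pinvmx R).
have KE : K = R^T *m M.
  rewrite -[LHS](mulmxKp Rfree) -AKR [in LHS]At AKR trmx_mul.
  by rewrite mulNmx mulmxN !mulmxA.
clearbody M.
have Mu : M \in unitmx.
  rewrite -row_full_unit /row_full eqn_leq rank_leq_row /=.
  by rewrite -{1}Kr KE mxrankM_maxr.
have AE : A = R^T *m M *m R by rewrite AKR KE.
exists R, M; split=> //; last by rewrite [LHS]hE AE !mulmxA.
have AA : A + A^T = - (A^T *m J *m A).
  by rewrite {1}At [in LHS]hE mulmxDr mulmx1 opprD addrAC addNr add0r mulmxA.
have RTfull : row_full R^T by rewrite /row_full mxrank_tr.
(* This is [AA] with the outer factors [R^T] and [R] cancelled. *)
have MM : M + M^T = - (M^T *m (R *m J *m R^T) *m M).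
  apply: (row_free_inj Rfree); apply: (row_full_inj RTfull).
  move: AA; rewrite AE !trmx_mul !trmxK !mulmxA => AA.
  by rewrite /= mulmxDr mulmxDl AA mulmxN mulNmx !mulmxA.
have := congr1 (fun Z => (invmx M)^T *m Z *m invmx M) MM.
rewrite /= mulmxDr mulmxDl !mulmxN !mulNmx !mulmxA -!trmx_mul.
rewrite (mulmxV Mu) trmx1 !mul1mx -!mulmxA (mulmxV Mu) !mulmx1.
by rewrite addrC !mulmxA.
Qed.

Lemma det_isometry (h : 'M[F]_N) :
  h^T *m J *m h = J -> \det h = (-1) ^+ \rank (h - 1%:M).
Proof.
move=> hJ; have [R [M [Mu MM hE]]] := wall_decomposition _ hJ.
(* The rank itself mentions [h], so it is generalized before [h] is rewritten. *)
move: (\rank _) R M Mu MM hE => r R M Mu MM hE.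
rewrite hE -(mulmxA (J *m R^T)) det_add1_mulmxC.
(* Adding [1] leaves [- M M^-T], and the determinants of [M] and [M^-T] cancel. *)
have -> : M *m R *m (J *m R^T) = - (1%:M + M *m (invmx M)^T).
  by rewrite -(mulmxV Mu) -mulmxDr MM mulmxN !mulmxA opprK.
rewrite opprD addrA subrr add0r -scaleN1r detZ det_mulmx det_tr.
by rewrite -det_mulmx mulmxV // det1 mulr1.
Qed.

Lemma wall_decomposition_padded (h : 'M[F]_N) (n k : nat) :
  n = (\rank (h - 1%:M)%R + (k + k))%N -> h^T *m J *m h = J ->
  exists (X : 'M[F]_(n, N)) (B : 'M[F]_n),
    [/\ B \in unitmx, B + B^T = - (X *m J *m X^T) &
        h = 1%:M + J *m X^T *m invmx B *m X].
Proof.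
move=> -> /wall_decomposition [R [M [Mu MM hE]]].
(* [S] is alternating with inverse [- S]: it adds nothing to [B + B^T], in accordance with the zero
   rows of [X]. *)
pose S : 'M[F]_(k + k) := block_mx 0 1%:M (- 1%:M) 0.
have SS : S *m - S = 1%:M.
  rewrite mulmxN mulmx_block !(mulmx0, mul0mx, mulmx1, mul1mx, add0r, addr0).
  by rewrite opp_block_mx !oppr0 opprK -scalar_mx_block.
have SST : S + S^T = 0.
  rewrite tr_block_mx add_block_mx !trmx0 raddfN /= trmx1 !addr0 subrr addNr.
  exact: block_mx0.
pose B := block_mx (invmx M) 0 0 S; pose C := block_mx M 0 0 (- S).
have BC : B *m C = 1%:M.
  rewrite mulmx_block !(mulmx0, mul0mx, addr0, add0r) mulVmx // SS.
  by rewrite -scalar_mx_block.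
have [Bu _] := mulmx1_unit BC.
have BV : invmx B = C by rewrite -[RHS](mulKmx Bu) BC mulmx1.
exists (col_mx R 0), B; split=> //.
- rewrite tr_block_mx add_block_mx SST MM !trmx0 !addr0 mul_col_mx tr_col_mx.
  by rewrite mul_col_row trmx0 !(mulmx0, mul0mx) opp_block_mx !oppr0.
- rewrite BV [LHS]hE tr_col_mx trmx0 mul_mx_row mulmx0 mul_row_block.
  by rewrite !(mulmx0, mul0mx, addr0) mul_row_col mulmx0 addr0.
Qed.

End WallForm.

Lemma antidiag_mxK (F : fieldType) (k : nat) :
  antidiag_mx F k *m antidiag_mx F k = 1%:M.
Proof.
apply/matrixP=> i j; rewrite !mxE (bigD1 (rev_ord i)) //= !mxE eqxx mul1r.
rewrite rev_ordK eq_sym big1 ?addr0 // => l /negbTE nl.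
by rewrite !mxE nl mul0r.
Qed.

Lemma tr_antidiag_mx (F : fieldType) (k : nat) :
  (antidiag_mx F k)^T = antidiag_mx F k.
Proof.
by apply/matrixP=> i j; rewrite !mxE -(inj_eq rev_ord_inj) rev_ordK eq_sym.
Qed.

Theorem lemma3p1 (F : fieldType) (hF : nonarchimedean_local_field F)
    (hchar : [pchar F] =i pred0) (n m : nat) (hn : n = (2 * m)%N)
    (h : 'M[F]_((2 * m).+1)) (hSO : SO_odd F m h) (hss : semisimple_mx h) :
  exists (Y : 'M[F]_n) (X : 'M[F]_(n, (2 * m).+1)),
    [/\ Y \in unitmx,
        Y + tilde_eps Y = X *m mx_prime X &
        SO_class h = SO_class (1%:M - mx_prime X *m invmx Y *m X)].
Proof.
case: hSO => hJ hdet.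
have JJ k := antidiag_mxK F k; have JT k := tr_antidiag_mx F k.
have reven : ~~ odd (\rank (h - 1%:M)).
  have := det_isometry _ _ _ (JJ _) (JT _) _ hJ.
  (* An odd rank would give [1 = -1], contrary to characteristic zero. *)
  rewrite hdet -signr_odd; case: (odd _) => // /esym/eqP.
  rewrite expr1 eq_sym -subr_eq0 opprK => two0.
  by have := hchar 2%N; rewrite !inE /= mulr2n two0.
have [k nE] : exists k, n = (\rank (h - 1%:M)%R + (k + k))%N.
  (* An even rank bounded by the odd size [2m + 1] is at most [2m], so this subtraction is not
     truncated. *)
  exists (m - (\rank (h - 1%:M)%R)./2)%N.
  by have := rank_leq_row (h - 1%:M); lia.
have [X [B [Bu BB hE]]] :=
  wall_decomposition_padded _ _ _ (JJ _) (JT _) _ _ _ nE hJ.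
have wu : antidiag_mx F n \in unitmx by case: (mulmx1_unit (JJ n)).
have wV : invmx (antidiag_mx F n) = antidiag_mx F n.
  by rewrite -[RHS](mulKmx wu) JJ mulmx1.
(* With [Y = B w], [tilde_eps Y = B^T w], so the condition on [Y] is the one on [B + B^T] times [w];
   in [X' Y^-1] the two factors [w] cancel. *)
exists (B *m antidiag_mx F n), X; split.
- by rewrite unitmx_mul Bu.
- rewrite /tilde_eps /mx_prime trmx_mul JT mulmxA JJ mul1mx -mulmxDl BB.
  by rewrite mulmxN mulNmx !mulmxA.
- congr SO_class; rewrite [LHS]hE /mx_prime; congr (_ + _).
  have -> : invmx (B *m antidiag_mx F n) = antidiag_mx F n *m invmx B.
    rewrite -[RHS](mulKmx (_ : B *m antidiag_mx F n \in unitmx)) ?unitmx_mul ?Bu //.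
    by rewrite -mulmxA (mulmxA (antidiag_mx F n)) JJ mul1mx mulmxV // mulmx1.
  rewrite !mulNmx opprK -!mulmxA; congr (_ *m (_ *m _)).
  by rewrite mulmxA JJ mul1mx.
Qed.
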